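(* The triple $\mathscr P_{\mathrm{fin}}=(\mathcal P_{\mathrm{fin},-},\eta,\mu)$ is a monad over the category $\mathbf{PSet}$ of pointed sets.
   Context: $\mathbf{PSet}$ is the category whose objects are pointed sets $(X,* )$ (a set $X$ with a chosen element $*\in X$) and whose morphisms $f:(X,* )\to(Y,\circ)$ are maps $f:X\to Y$ with $f( * )=\circ$. For a pointed set $(X,* )$ put $$\mathcal P_{\mathrm{fin},*}(X,* )=\bigl(\{A\subseteq X: A\text{ is finite and }*\in A\},\ \{*\}\bigr),$$ a pointed set with basepoint $\{*\}$. The functor $\mathcal P_{\mathrm{fin},-}:\mathbf{PSet}\to\mathbf{PSet}$ sends $(X,* )$ to $\mathcal P_{\mathrm{fin},*}(X,* )$ and a morphism $f$ to the direct image map $A\mapsto f[A]=\{f(a):a\in A\}$. The maps $\eta$ and $\mu$ are given by $$\eta_{(X,* )}(x)=\{x,*\}\quad(x\in X),\qquad \mu_{(X,* )}(\mathcal A)=\bigcup_{A\in\mathcal A}A\quad(\mathcal A\in\mathcal P_{\mathrm{fin},-}(\mathcal P_{\mathrm{fin},-}(X,* ))).$$ A monad over a category $\mathbf C$ is a triple $(T,\eta,\mu)$ with $T:\mathbf C\to\mathbf C$ a functor and $\eta:\mathrm{id}_{\mathbf C}\to T$, $\mu:T\circ T\to T$ natural transformations such that $\mu_X\circ T(\eta_X)=\mathrm{id}_{TX}$, $\mu_X\circ\eta_{TX}=\mathrm{id}_{TX}$ and $\mu_X\circ T(\mu_X)=\mu_X\circ\mu_{TX}$ for every object $X$. *)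

(* Defs.v *)
From mathcomp Require Import all_boot.
From mathcomp Require Import boolp classical_sets functions cardinality.

Set Implicit Arguments.
Unset Strict Implicit.
Unset Printing Implicit Defensive.

Local Open Scope classical_set_scope.

Record category := Category {
  obj :> Type;
  hom : obj -> obj -> Type;
  idm : forall X, hom X X;
  compm : forall X Y Z, hom Y Z -> hom X Y -> hom X Z;
  compm1 : forall X Y (f : hom X Y), compm f (idm X) = f;
  comp1m : forall X Y (f : hom X Y), compm (idm Y) f = f;
  compmA : forall X Y Z W (h : hom Z W) (g : hom Y Z) (f : hom X Y),
    compm h (compm g f) = compm (compm h g) f }.

Arguments hom {c}.
Arguments idm {c}.
Arguments compm {c X Y Z}.

(* The functor laws are deliberately not fields: they are [is_functor]. *)
Record functor_data (C D : category) := FunctorData {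
  fobj :> C -> D;
  fmap : forall X Y : C, hom X Y -> hom (fobj X) (fobj Y) }.

Arguments FunctorData {C D fobj}.
Arguments fmap {C D} f {X Y}.

Definition is_functor (C D : category) (F : functor_data C D) : Prop :=
  (forall X : C, fmap F (idm X) = idm (F X)) /\
  (forall (X Y Z : C) (g : hom Y Z) (f : hom X Y),
     fmap F (compm g f) = compm (fmap F g) (fmap F f)).

Definition id_functor (C : category) : functor_data C C :=
  FunctorData (fun X Y (f : hom X Y) => f).

Definition comp_functor (C D E : category)
    (G : functor_data D E) (F : functor_data C D) : functor_data C E :=
  FunctorData (fun X Y (f : hom X Y) => fmap G (fmap F f)).

Definition is_natural (C D : category) (F G : functor_data C D)
    (a : forall X : C, hom (F X) (G X)) : Prop :=
  forall (X Y : C) (f : hom X Y),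
    compm (a Y) (fmap F f) = compm (fmap G f) (a X).

Definition is_monad (C : category) (T : functor_data C C)
    (eta : forall X : C, hom (id_functor C X) (T X))
    (mu : forall X : C, hom (comp_functor T T X) (T X)) : Prop :=
  [/\ is_functor T, @is_natural C C (id_functor C) T eta &
      @is_natural C C (comp_functor T T) T mu] /\
  [/\ forall X : C, compm (mu X) (fmap T (eta X)) = idm (T X),
      forall X : C, compm (mu X) (eta (T X)) = idm (T X) &
      forall X : C, compm (mu X) (fmap T (mu X)) = compm (mu X) (mu (T X))].

(* The library's [pointedType] also carries a choice structure; a pointed set
   is an arbitrary type with a point. *)
Record pset := PointedSet { carrier :> Type; pt : carrier }.

Arguments pt : clear implicits.

Record pmap (X Y : pset) := PMap { pfun :> X -> Y; pfun_pt : pfun (pt X) = pt Y }.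

Lemma pmap_ext (X Y : pset) (f g : pmap X Y) : pfun f =1 pfun g -> f = g.
Proof.
case: f g => [f pf] [g pg] /= /funext fg; case: _ / fg in pg *.
by congr PMap; exact: Prop_irrelevance.
Qed.

Definition pid (X : pset) : pmap X X := @PMap X X id erefl.

Lemma pcomp_pt (X Y Z : pset) (g : pmap Y Z) (f : pmap X Y) :
  (g \o f) (pt X) = pt Z.
Proof. by rewrite /= !pfun_pt. Qed.

Definition pcomp (X Y Z : pset) (g : pmap Y Z) (f : pmap X Y) : pmap X Z :=
  PMap (pcomp_pt g f).

Lemma pcompm1 (X Y : pset) (f : pmap X Y) : pcomp f (pid X) = f.
Proof. exact: pmap_ext. Qed.

Lemma pcomp1m (X Y : pset) (f : pmap X Y) : pcomp (pid Y) f = f.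
Proof. exact: pmap_ext. Qed.

Lemma pcompA (X Y Z W : pset) (h : pmap Z W) (g : pmap Y Z) (f : pmap X Y) :
  pcomp h (pcomp g f) = pcomp (pcomp h g) f.
Proof. exact: pmap_ext. Qed.

Definition PSet : category := Category pcompm1 pcomp1m pcompA.

Record pfin_set (X : pset) := PFinSet {
  pfin_val :> set X;
  pfin_finite : finite_set pfin_val;
  pfin_pt : pfin_val (pt X) }.

Lemma pfin_set_ext (X : pset) (A B : pfin_set X) :
  pfin_val A = pfin_val B -> A = B.
Proof.
case: A B => [A fA pA] [B fB pB] /= AB; case: _ / AB in fB pB *.
by congr PFinSet; exact: Prop_irrelevance.
Qed.

Definition pfin (X : pset) : pset :=
  PointedSet (PFinSet (finite_set1 (pt X)) (erefl (pt X))).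

Section Pfin_map.
Variables (X Y : pset) (f : pmap X Y).

Lemma image_pt (A : pfin X) : (f @` A) (pt Y).
Proof. by exists (pt X); [exact: pfin_pt | exact: pfun_pt]. Qed.

Definition pfin_image (A : pfin X) : pfin Y :=
  PFinSet (finite_image f (pfin_finite A)) (image_pt A).

Lemma pfin_image_pt : pfin_image (pt (pfin X)) = pt (pfin Y).
Proof. by apply: pfin_set_ext; rewrite /= image_set1 pfun_pt. Qed.

Definition pfin_map : pmap (pfin X) (pfin Y) := PMap pfin_image_pt.

End Pfin_map.

Definition Pfin : functor_data PSet PSet :=
  @FunctorData PSet PSet pfin pfin_map.

Section Eta.
Variable X : pset.

Definition eta_fun (x : X) : pfin X :=
  @PFinSet X [set x; pt X] (finite_set2 x (pt X)) (or_intror erefl).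

Lemma eta_fun_pt : eta_fun (pt X) = pt (pfin X).
Proof. by apply: pfin_set_ext; rewrite /= setUid. Qed.

Definition Pfin_eta : pmap X (pfin X) := PMap eta_fun_pt.

End Eta.

Section Mu.
Variable X : pset.

Lemma bigcup_pfin_finite (AA : pfin (pfin X)) :
  finite_set (\bigcup_(A in pfin_val AA) pfin_val A).
Proof. by apply: bigcup_finite => [|A _]; exact: pfin_finite. Qed.

Lemma bigcup_pfin_pt (AA : pfin (pfin X)) :
  (\bigcup_(A in pfin_val AA) pfin_val A) (pt X).
Proof. by exists (pt (pfin X)); [exact: pfin_pt|]. Qed.

Definition mu_fun (AA : pfin (pfin X)) : pfin X :=
  PFinSet (bigcup_pfin_finite AA) (bigcup_pfin_pt AA).

Lemma mu_fun_pt : mu_fun (pt (pfin (pfin X))) = pt (pfin X).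
Proof. by apply: pfin_set_ext; rewrite /= bigcup_set1. Qed.

Definition Pfin_mu : pmap (pfin (pfin X)) (pfin X) := PMap mu_fun_pt.

End Mu.

(* Main.v *)
From mathcomp Require Import all_boot.
From mathcomp Require Import classical_sets.
Require Import Defs.

Local Open Scope classical_set_scope.

(** Morphisms into [pfin Y] agree once their values agree as subsets, so each law becomes an
    identity of images and unions. Functoriality, naturality of [Pfin_mu] and associativity hold as
    for the powerset monad: images commute with unions and nested unions flatten. The basepoint
    enters through the unit: [Pfin_eta] is natural because morphisms preserve it, and the unit laws
    hold because every member of [pfin X] contains it. *)

Lemma pmap_pfin_ext (X Y : pset) (f g : pmap X (pfin Y)) :
  (forall x, pfin_val (f x) = pfin_val (g x)) -> f = g.
Proof. by move=> fg; apply: pmap_ext => x; apply: pfin_set_ext. Qed.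

Lemma Pfin_is_functor : is_functor Pfin.
Proof.
split=> [X|X Y Z g f]; apply: pmap_pfin_ext => A /=.
  exact: image_id.
by rewrite image_comp.
Qed.

Lemma Pfin_eta_natural : @is_natural PSet PSet (id_functor PSet) Pfin Pfin_eta.
Proof.
move=> X Y f; apply: pmap_pfin_ext => x /=.
by rewrite image_setU !image_set1 pfun_pt.
Qed.

Lemma Pfin_mu_natural :
  @is_natural PSet PSet (comp_functor Pfin Pfin) Pfin Pfin_mu.
Proof.
move=> X Y f; apply: pmap_pfin_ext => AA /=.
by rewrite bigcup_image image_bigcup.
Qed.

(** The pairs {a, *} with a in A cover A and add at most *, already in A. *)
Lemma Pfin_mu_map_eta (X : pset) :
  pcomp (Pfin_mu X) (pfin_map (Pfin_eta X)) = pid (pfin X).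
Proof.
apply: pmap_pfin_ext => A /=; rewrite bigcup_image /=.
apply/seteqP; split=> [x [a Aa [->//|->]]|x Ax]; first exact: pfin_pt.
by exists x => //; left.
Qed.

Lemma Pfin_mu_eta (X : pset) :
  pcomp (Pfin_mu X) (Pfin_eta (pfin X)) = pid (pfin X).
Proof.
apply: pmap_pfin_ext => A /=; rewrite bigcup_setU !bigcup_set1 /=.
(* The union of {A, {*}} is A together with *, and * lies in A. *)
by apply/setUidPl => _ ->; exact: pfin_pt.
Qed.

Lemma Pfin_mu_assoc (X : pset) :
  pcomp (Pfin_mu X) (pfin_map (Pfin_mu X)) =
  pcomp (Pfin_mu X) (Pfin_mu (pfin X)).
Proof.
apply: pmap_pfin_ext => AAA /=; rewrite bigcup_image /=.
by rewrite bigcup_bigcup.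
Qed.

Theorem theorem3 : @is_monad PSet Pfin Pfin_eta Pfin_mu.
Proof.
split; split.
- exact: Pfin_is_functor.
- exact: Pfin_eta_natural.
- exact: Pfin_mu_natural.
- exact: Pfin_mu_map_eta.
- exact: Pfin_mu_eta.
- exact: Pfin_mu_assoc.
Qed.
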